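(* Let $A\in\mathbb{R}^{n\times n}$ and $B\in\mathbb{R}^{n\times 1}$ be such that $(A,B)$ is completely controllable, and consider the single-input linear system $x(k+1)=Ax(k)+Bu(k)$, $k=0,1,2,\dots$, with $x(k)\in\mathbb{R}^n$, $u(k)\in\mathbb{R}$, and no constraints on states or controls. Let $Q\in\mathbb{R}^{n\times n}$ be positive definite and $R>0$. At each time $k$, given $x(k)$, consider the optimization problem over $U(k)=[u(0|k),\dots,u(n-1|k)]^T\in\mathbb{R}^n$: $$U^\ast(k)=\arg\min_{U(k)}\ \sum_{i=1}^n\Big(\|x(i|k)\|_Q^2+\|u(i-1|k)\|_R^2\Big)$$ subject to $$x(i+1|k)=Ax(i|k)+Bu(i|k),\quad i=0,\dots,n-1,\qquad x(0|k)=x(k),\qquad x(n|k)=0,$$ and let the control be implemented in receding horizon fashion by $u(k)=[1\ 0\ \cdots\ 0]\,U^\ast(k)$. Then: 1) the optimization problem is feasible globally, i.e. it is feasible for every state $x(k)\in\mathbb{R}^n$; 2) for every initial state $x(0)\in\mathbb{R}^n$, the closed-loop state satisfies $x(k)=0$ for all $k>n$.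
   Context: Notation: $(i|k)$ denotes the prediction $i$ steps ahead from time $k$; $\|v\|_M^2=v^TMv$. The control horizon and the prediction horizon both equal the state dimension $n$. *)

(* Defs.v *)
From HB Require Import structures.
From mathcomp Require Import all_boot all_order all_algebra.
From mathcomp Require Import reals.

Set Implicit Arguments.
Unset Strict Implicit.
Unset Printing Implicit Defensive.

Import Order.TTheory GRing.Theory Num.Theory.

Local Open Scope ring_scope.

Section ModelPredictiveControl.

Variables (R : realType) (n : nat).

Implicit Types (A Q : 'M[R]_n) (B x : 'cV[R]_n) (U : 'cV[R]_n).
Implicit Types (X : nat -> 'cV[R]_n) (u : nat -> R) (r : R).

Definition solution A B X u : Prop :=
  forall k : nat, X k.+1 = A *m X k + u k *: B.

(* Transfer between any two states (not merely to the origin, which is weaker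
   when A is singular) in finitely many steps. *)
Definition completely_controllable A B : Prop :=
  forall x0 x1 : 'cV[R]_n, exists (N : nat) X u,
    [/\ solution A B X u, X 0%N = x0 & X N = x1].

Definition wnorm2 Q (v : 'cV[R]_n) : R := (v^T *m Q *m v) 0 0.

(* Symmetry of Q is not required, so symmetric positive definite matrices are
   a particular case. *)
Definition posdef Q : Prop := forall v : 'cV[R]_n, v != 0 -> 0 < wnorm2 Q v.

(* U i 0 is u(i|k) and X i is x(i|k); only X 0, ..., X n are relevant. *)
Definition feasible_pair A B x U X : Prop :=
  [/\ X 0%N = x,
      forall i : 'I_n, X i.+1 = A *m X i + U i 0 *: B
    & X n = 0].

Definition feasible A B x : Prop := exists U X, feasible_pair A B x U X.

Definition cost Q r U X : R :=
  \sum_(i < n) (wnorm2 Q (X i.+1) + r * U i 0 ^+ 2).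

Definition is_argmin A B Q r x U : Prop :=
  exists2 X, feasible_pair A B x U X &
    forall U' X', feasible_pair A B x U' X' -> cost Q r U X <= cost Q r U' X'.

Definition first_input U : R :=
  ((\row_(j < n) (j == 0 :> nat)%:R : 'rV[R]_n) *m U) 0 0.

Definition closed_loop A B Q r X : Prop :=
  exists2 Ustar : nat -> 'cV[R]_n,
    forall k : nat, is_argmin A B Q r (X k) (Ustar k) &
    solution A B X (fun k => first_input (Ustar k)).

End ModelPredictiveControl.

(* Main.v *)
Require Import Defs.
From mathcomp Require Import all_boot all_order all_algebra.
From mathcomp Require Import reals.

(** With horizon [n] equal to the state dimension and a single input, the
    terminal constraint [x(n|k) = 0] is the square linear system
    [A ^+ n *m x + C *m U = 0], where [C] is the controllability matrix.
    Controllability makes [C] invertible: by Cayley-Hamilton the states reached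
    from the origin in any number of steps already lie in the column space of
    [C] ([controllability_mx_unit]).  So every state has exactly one feasible
    input vector ([feasible_pair_inj], [deadbeat_solution]), and the
    optimisation has no freedom left: any feasible vector is optimal
    ([feasible_is_argmin]).

    Continue the feasible plan computed at time 0 with zero inputs.  It reaches
    the origin at time [n] and rests there, so each of its windows of length [n]
    again ends at the origin: it is feasible, hence is the optimal plan from the
    state where it starts ([deadbeat_window_feasible]).  By induction the
    closed loop never leaves the plan made at time 0
    ([closed_loop_eq_deadbeat]), and therefore it vanishes from time [n] on. *)

Set Implicit Arguments.
Unset Strict Implicit.
Unset Printing Implicit Defensive.

Import Order.TTheory GRing.Theory Num.Theory.

Local Open Scope ring_scope.

(** Variation of constants.  The recurrence is assumed only before time [N],
    because a predicted trajectory is constrained only up to the horizon. *)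
Lemma variation_of_constants (R : comPzRingType) (n : nat) (A : 'M[R]_n)
    (B : 'cV[R]_n) (X : nat -> 'cV[R]_n) (u : nat -> R) (N : nat) :
  (forall k, (k < N)%N -> X k.+1 = A *m X k + u k *: B) ->
  X N = A ^+ N *m X 0%N + \sum_(i < N) u i *: (A ^+ (N - i.+1) *m B).
Proof.
elim: N => [|N IHN] dynX; first by rewrite big_ord0 addr0 expr0 mul1mx.
rewrite dynX // IHN => [|k ltkN]; last exact/dynX/ltnW.
rewrite mulmxDr mulmxA mulmxE -exprS -addrA; congr (_ + _).
rewrite big_ord_recr /= subnn expr0 mul1mx mulmx_sumr; congr (_ + _).
apply: eq_bigr => i _.
by rewrite subSS -scalemxAr mulmxA mulmxE -exprS -subSn.
Qed.

(** Cayley-Hamilton: reduce ['X^k] modulo the characteristic polynomial. *)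
Lemma mx_exp_lincomb (F : fieldType) (n : nat) (A : 'M[F]_n) (k : nat) :
  exists c : 'I_n -> F, A ^+ k = \sum_(i < n) c i *: A ^+ i.
Proof.
case: n A => [|n] A.
  by exists (fun=> 0); rewrite [LHS]flatmx0 [RHS]flatmx0.
pose p := 'X^k %% char_poly A.
exists (fun i => p`_i).
have p_small : (size p <= n.+1)%N.
  by rewrite -ltnS -(size_char_poly A) ltn_modpN0 // monic_neq0 ?char_poly_monic.
have -> : A ^+ k = horner_mx A p.
  have <- : horner_mx A 'X^k = A ^+ k by rewrite rmorphXn /= horner_mx_X.
  rewrite [X in horner_mx A X = _](divp_eq 'X^k (char_poly A)).
  by rewrite rmorphD rmorphM /= Cayley_Hamilton mulr0 add0r.
have -> : p = \sum_(i < n.+1) p`_i *: 'X^i.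
  rewrite -poly_def; apply/polyP => i; rewrite coef_poly.
  by case: ltnP => // le_n_i; rewrite nth_default // (leq_trans p_small).
rewrite raddf_sum; apply: eq_bigr => i _ /=.
by rewrite horner_mxZ rmorphXn /= horner_mx_X -poly_def coef_poly ltn_ord.
Qed.

(** The usual matrix [B, A B, ..., A^(n-1) B] with its columns reversed, so that
    column [j] is the effect at time [n] of a unit input at time [j]. *)
Definition controllability_mx (R : pzRingType) (n : nat) (A : 'M[R]_n)
    (B : 'cV[R]_n) : 'M[R]_n :=
  \matrix_(i, j) (A ^+ (n - j.+1) *m B) i 0.

Lemma col_controllability_mx (R : pzRingType) (n : nat) (A : 'M[R]_n)
    (B : 'cV[R]_n) (j : 'I_n) :
  col j (controllability_mx A B) = A ^+ (n - j.+1) *m B.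
Proof. by apply/colP => i; rewrite !mxE. Qed.

Lemma mul_controllability_mx (R : comPzRingType) (n : nat) (A : 'M[R]_n)
    (B U : 'cV[R]_n) :
  controllability_mx A B *m U =
  \sum_(j < n) U j 0 *: (A ^+ (n - j.+1) *m B).
Proof.
apply/colP => i; rewrite mxE summxE; apply: eq_bigr => j _.
by rewrite !mxE mulrC; congr (_ * _); rewrite mxE.
Qed.

(** A row vector that annihilates the columns of the matrix annihilates every
    [A ^+ k *m B] by Cayley-Hamilton, hence every state reached from the origin,
    that is, the whole space. *)
Lemma controllability_mx_unit (R : realType) (n : nat) (A : 'M[R]_n)
    (B : 'cV[R]_n) :
  completely_controllable A B -> controllability_mx A B \in unitmx.
Proof.
move=> ctrlAB; rewrite -row_free_unit; apply: inj_row_free => w wC0.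
have wAB0_small (i : 'I_n) : w *m (A ^+ i *m B) = 0.
  have -> : A ^+ i *m B = col (rev_ord i) (controllability_mx A B).
    rewrite col_controllability_mx.
    by rewrite -[(n - _)%N]/(rev_ord (rev_ord i) : nat) rev_ordK.
  by rewrite colE mulmxA wC0 mul0mx.
have wAB0 k : w *m (A ^+ k *m B) = 0.
  have [c ->] := mx_exp_lincomb A k.
  rewrite mulmx_suml mulmx_sumr big1 // => i _.
  by rewrite -scalemxAl -scalemxAr wAB0_small scaler0.
have w_kills (v : 'cV_n) : w *m v = 0.
  have [N [X [u [dynX X0 <-]]]] := ctrlAB 0 v.
  rewrite (variation_of_constants (fun k _ => dynX k)) X0 mulmx0 add0r.
  by rewrite mulmx_sumr big1 // => i _; rewrite -scalemxAr wAB0 scaler0.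
apply/rowP => j; have := congr1 (fun M : 'M_1 => M 0 0) (w_kills (delta_mx j 0)).
by rewrite -colE !mxE.
Qed.

Definition zero_extend (R : pzRingType) (n : nat) (U : 'cV[R]_n) (k : nat) : R :=
  oapp (fun i : 'I_n => U i 0) 0 (insub k).

Lemma zero_extend_ord (R : pzRingType) (n : nat) (U : 'cV[R]_n) (i : 'I_n) :
  zero_extend U i = U i 0.
Proof. by rewrite /zero_extend valK. Qed.

Lemma zero_extend_ge (R : pzRingType) (n : nat) (U : 'cV[R]_n) (k : nat) :
  (n <= k)%N -> zero_extend U k = 0.
Proof. by move=> le_nk; rewrite /zero_extend insubF // ltnNge le_nk. Qed.

Lemma horizon_state (R : comPzRingType) (n : nat) (A : 'M[R]_n) (B U : 'cV[R]_n)
    (X : nat -> 'cV[R]_n) :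
  (forall i : 'I_n, X i.+1 = A *m X i + U i 0 *: B) ->
  X n = A ^+ n *m X 0%N + controllability_mx A B *m U.
Proof.
move=> dynX; rewrite (@variation_of_constants _ _ A B X (zero_extend U)).
  rewrite mul_controllability_mx; congr (_ + _); apply: eq_bigr => i _.
  by rewrite zero_extend_ord.
by move=> k ltkn; rewrite (dynX (Ordinal ltkn)) -zero_extend_ord.
Qed.

Lemma feasible_pair_inj (R : realType) (n : nat) (A : 'M[R]_n)
    (B x U U' : 'cV[R]_n) (X X' : nat -> 'cV[R]_n) :
  completely_controllable A B ->
  feasible_pair A B x U X -> feasible_pair A B x U' X' ->
  U = U' /\ (forall i, (i <= n)%N -> X i = X' i).
Proof.
move=> /controllability_mx_unit unitC [X0 dynX Xn] [X'0 dynX' X'n].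
have eqU : U = U'.
  apply: (can_inj (mulKmx unitC)); apply: (addrI (A ^+ n *m x)).
  by rewrite -{1}X0 -X'0 -(horizon_state dynX) -(horizon_state dynX') Xn X'n.
split=> //; elim=> [|i IHi] lein; first by rewrite X0 X'0.
by rewrite (dynX (Ordinal lein)) (dynX' (Ordinal lein)) eqU IHi // ltnW.
Qed.

Lemma feasible_is_argmin (R : realType) (n : nat) (A Q : 'M[R]_n)
    (B x U : 'cV[R]_n) (r : R) (X : nat -> 'cV[R]_n) :
  completely_controllable A B ->
  feasible_pair A B x U X -> is_argmin A B Q r x U.
Proof.
move=> ctrlAB feasX; exists X => // U' X' feasX'.
have [-> eqX] := feasible_pair_inj ctrlAB feasX feasX'.
suff -> : cost Q r U' X = cost Q r U' X' by [].
by apply: eq_bigr => i _; rewrite eqX.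
Qed.

Definition deadbeat (R : realType) (n : nat) (A : 'M[R]_n) (B : 'cV[R]_n)
    (z : nat -> 'cV[R]_n) (u : nat -> R) : Prop :=
  solution A B z u /\ (forall k, (n <= k)%N -> z k = 0).

(** Solve the terminal constraint for the first [n] inputs, then switch the
    input off: the origin is an equilibrium. *)
Lemma deadbeat_solution (R : realType) (n : nat) (A : 'M[R]_n)
    (B x : 'cV[R]_n) :
  completely_controllable A B ->
  exists z u, z 0%N = x /\ deadbeat A B z u.
Proof.
move=> /controllability_mx_unit unitC.
pose U := invmx (controllability_mx A B) *m (- (A ^+ n *m x)).
pose z := nat_rect (fun=> 'cV[R]_n) x (fun k v => A *m v + zero_extend U k *: B).
exists z, (zero_extend U); split=> //; split=> // k /subnK <-.
elim: (k - n)%N => [|d IHd].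
  rewrite add0n (@horizon_state _ _ A B U) => [|i].
    by rewrite mulKVmx // subrr.
  by rewrite /= zero_extend_ord.
by rewrite addSn /= IHd mulmx0 add0r zero_extend_ge ?scale0r // leq_addl.
Qed.

Definition window (R : pzRingType) (n : nat) (u : nat -> R) (k : nat) :
  'cV[R]_n := \col_i u (k + i)%N.

(** When [n = 0] there is no first input, but then [B] is empty too. *)
Lemma first_input_window (R : realType) (n : nat) (B : 'cV[R]_n)
    (u : nat -> R) (k : nat) :
  first_input (window n u k) *: B = u k *: B.
Proof.
case: n B => [|n] B; first by rewrite [LHS]flatmx0 [RHS]flatmx0.
congr (_ *: _); rewrite /first_input mxE big_ord_recl big1 => [|i _].
  by rewrite !mxE /= mul1r addn0 addr0.
by rewrite !mxE mul0r.
Qed.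

Lemma deadbeat_window_feasible (R : realType) (n : nat) (A : 'M[R]_n)
    (B : 'cV[R]_n) (z : nat -> 'cV[R]_n) (u : nat -> R) (k : nat) :
  deadbeat A B z u ->
  feasible_pair A B (z k) (window n u k) (fun i => z (k + i)%N).
Proof.
move=> [dynz z_end]; split; first by rewrite addn0.
  by move=> i; rewrite addnS dynz mxE.
by rewrite z_end // leq_addl.
Qed.

Lemma deadbeat_closed_loop (R : realType) (n : nat) (A Q : 'M[R]_n)
    (B : 'cV[R]_n) (r : R) (z : nat -> 'cV[R]_n) (u : nat -> R) :
  completely_controllable A B -> deadbeat A B z u -> closed_loop A B Q r z.
Proof.
move=> ctrlAB dbz; exists (window n u) => k.
  exact/(feasible_is_argmin _ _ ctrlAB)/deadbeat_window_feasible.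
by rewrite first_input_window; apply: dbz.1.
Qed.

(** Principle of optimality: the plan computed at time [k + 1] can only be the
    rest of the plan computed at time [k]. *)
Lemma closed_loop_eq_deadbeat (R : realType) (n : nat) (A Q : 'M[R]_n)
    (B : 'cV[R]_n) (r : R) (x z : nat -> 'cV[R]_n) (u : nat -> R) :
  completely_controllable A B -> closed_loop A B Q r x ->
  deadbeat A B z u -> x 0%N = z 0%N -> x =1 z.
Proof.
move=> ctrlAB [Ustar optU dynx] dbz eq0; elim=> [//|k IHk].
have [X feasX _] := optU k; rewrite IHk in feasX.
have [eqU _] := feasible_pair_inj ctrlAB feasX (deadbeat_window_feasible k dbz).
by rewrite dynx eqU first_input_window IHk dbz.1.
Qed.

Theorem theorem1 (R : realType) (n : nat) (A : 'M[R]_n) (B : 'cV[R]_n)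
    (Q : 'M[R]_n) (r : R)
    (hAB : completely_controllable A B) (hQ : posdef Q) (hr : 0 < r) :
  (forall x : 'cV[R]_n, feasible A B x) /\
  (forall x0 : 'cV[R]_n,
     (exists2 x : nat -> 'cV[R]_n, x 0%N = x0 & closed_loop A B Q r x) /\
     (forall x : nat -> 'cV[R]_n, x 0%N = x0 -> closed_loop A B Q r x ->
        forall k : nat, (n < k)%N -> x k = 0)).
Proof.
split=> x0; have [z [u [z0 dbz]]] := deadbeat_solution x0 hAB.
  rewrite -z0; exists (window n u 0), (fun i => z (0 + i)%N).
  exact: deadbeat_window_feasible.
split=> [|x xx0 loopx k /ltnW le_nk].
  by exists z => //; apply: deadbeat_closed_loop dbz.
by rewrite (closed_loop_eq_deadbeat hAB loopx dbz) ?xx0 // dbz.2.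
Qed.
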